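(* Let $\lambda$ be a nonzero real number. For every integer $n\ge 0$ and every positive integer $r$ (and every real $x$), $$\mathcal{E}_{n,\lambda}^{(r)}(x+2)+\sum_{l=0}^{r-1}2^{l}\,\mathcal{E}_{n,\lambda}^{(r-l)}(x-l)=2^{r}\,(x-r+2)_{n,\lambda}.$$
   Context: All generating functions are formal power series in $t$ with real coefficients. For $x\in\mathbb{R}$: $(x)_{0,\lambda}=1$, $(x)_{n,\lambda}=x(x-\lambda)\cdots(x-(n-1)\lambda)$ for $n\ge 1$. The degenerate exponential is $e_\lambda^x(t)=(1+\lambda t)^{x/\lambda}=\sum_{n\ge0}(x)_{n,\lambda}\frac{t^n}{n!}$, $e_\lambda(t)=e_\lambda^1(t)$ (and $e_\lambda^{-1}(t)$ is the case $x=-1$). The type 2 degenerate Euler polynomials of order $r$ ($r$ a positive integer) are defined by $\left(\frac{2}{e_\lambda(t)+e_\lambda^{-1}(t)}\right)^r e_\lambda^x(t)=\sum_{n\ge0}\mathcal{E}_{n,\lambda}^{(r)}(x)\frac{t^n}{n!}$. *)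

(* Defs.v *)
From HB Require Import structures.
From mathcomp Require Import all_boot all_order all_algebra.
From mathcomp Require Import boolp reals.

Set Implicit Arguments.
Unset Strict Implicit.
Unset Printing Implicit Defensive.

Import Order.TTheory GRing.Theory Num.Theory.
Local Open Scope ring_scope.

(* Formal power series in one variable [t]; [coef a n] is the coefficient of
   [t ^ n].  A record rather than an alias of [nat -> R], so that the Cauchy
   product cannot be confused with the pointwise product of functions. *)
Record fps (R : Type) := Fps { coef : nat -> R }.

HB.instance Definition _ (R : Type) := [isNew for @coef R].
HB.instance Definition _ (R : choiceType) := [Choice of fps R by <:].

Lemma fpsP (R : Type) (a b : fps R) : (forall n, coef a n = coef b n) <-> a = b.
Proof.
split=> [|->//]; case: a b => [a] [b] /= ab; congr Fps; exact: funext.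
Qed.

Section FpsZmodule.
Variable R : zmodType.
Implicit Types a b c : fps R.

Definition fps_zero : fps R := Fps (fun=> 0).
Definition fps_opp a : fps R := Fps (fun n => - coef a n).
Definition fps_add a b : fps R := Fps (fun n => coef a n + coef b n).

Fact fps_addA : associative fps_add.
Proof. by move=> a b c; apply/fpsP => n /=; rewrite addrA. Qed.
Fact fps_addC : commutative fps_add.
Proof. by move=> a b; apply/fpsP => n /=; rewrite addrC. Qed.
Fact fps_add0 : left_id fps_zero fps_add.
Proof. by move=> a; apply/fpsP => n /=; rewrite add0r. Qed.
Fact fps_addN : left_inverse fps_zero fps_opp fps_add.
Proof. by move=> a; apply/fpsP => n /=; rewrite addNr. Qed.

HB.instance Definition _ :=
  GRing.isZmodule.Build (fps R) fps_addA fps_addC fps_add0 fps_addN.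

End FpsZmodule.

Section FpsRing.
Variable R : comNzRingType.
Implicit Types a b c : fps R.

Definition fps_one : fps R := Fps (fun n => (n == 0)%:R).
Definition fps_mul a b : fps R :=
  Fps (fun n => \sum_(i < n.+1) coef a i * coef b (n - i)).

Fact fps_mulC : commutative fps_mul.
Proof.
move=> a b; apply/fpsP => n /=; rewrite (reindex_inj rev_ord_inj) /=.
by apply: eq_bigr => i _; rewrite subSS subKn ?leq_ord // mulrC.
Qed.

Let coef_mul_rev a b n :
  coef (fps_mul a b) n = \sum_(i < n.+1) coef a (n - i) * coef b i.
Proof.
by rewrite fps_mulC; apply: eq_bigr => i _; rewrite mulrC.
Qed.

Fact fps_mulA : associative fps_mul.
Proof.
move=> p q r; apply/fpsP => i; rewrite [RHS]coef_mul_rev.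
pose coef3 j k := coef p j * (coef q (i - j - k) * coef r k).
transitivity (\sum_(j < i.+1) \sum_(k < i.+1 | (k <= i - j)%N) coef3 j k).
  apply: eq_bigr => j _; rewrite [X in _ * X]coef_mul_rev.
  by rewrite big_distrr /= (big_ord_narrow_leq (leq_subr _ _)).
rewrite (exchange_big_dep predT) //=; apply: eq_bigr => k _.
transitivity (\sum_(j < i.+1 | (j <= i - k)%N) coef3 j k).
  apply: eq_bigl => j; rewrite -ltnS -(ltnS j) -!subSn ?leq_ord //.
  by rewrite -subn_gt0 -(subn_gt0 j) -!subnDA addnC.
rewrite (big_ord_narrow_leq (leq_subr _ _)) big_distrl /=.
by apply: eq_bigr => j _; rewrite /coef3 -!subnDA addnC mulrA.
Qed.

Fact fps_mul1 : left_id fps_one fps_mul.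
Proof.
move=> a; apply/fpsP => n /=; rewrite big_ord_recl /= mul1r subn0.
by rewrite big1 ?addr0 // => i _; rewrite mul0r.
Qed.

Fact fps_mulDl : left_distributive fps_mul +%R.
Proof.
move=> a b c; apply/fpsP => n; apply: etrans (big_split _ _ _ _ _).
by apply: eq_bigr => i _; rewrite mulrDl.
Qed.

Fact fps_one_neq0 : fps_one != 0.
Proof.
apply/eqP => /fpsP /(_ 0%N) /= /eqP; by rewrite oner_eq0.
Qed.

HB.instance Definition _ := GRing.Zmodule_isComNzRing.Build (fps R)
  fps_mulA fps_mulC fps_mul1 fps_mulDl fps_one_neq0.

End FpsRing.

Section FpsCoef.
Variable R : comNzRingType.
Implicit Types a b : fps R.

Lemma fps_coef0 n : coef (0 : fps R) n = 0. Proof. by []. Qed.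
Lemma fps_coefN a n : coef (- a) n = - coef a n. Proof. by []. Qed.
Lemma fps_coefD a b n : coef (a + b) n = coef a n + coef b n. Proof. by []. Qed.
Lemma fps_coef1 n : coef (1 : fps R) n = (n == 0)%:R. Proof. by []. Qed.
Lemma fps_coefM a b n :
  coef (a * b) n = \sum_(i < n.+1) coef a i * coef b (n - i).
Proof. by []. Qed.

End FpsCoef.

Section FpsUnitRing.
Variable R : fieldType.
Implicit Types a b : fps R.

(* The first [n] coefficients of [a^-1], each obtained from the previous ones
   by solving the equation for the corresponding coefficient of
   [a^-1 * a = 1]. *)
Fixpoint fps_inv_seq a n : seq R :=
  if n is m.+1 then
    let s := fps_inv_seq a m in
    rcons s (((m == 0)%:R - \sum_(i < m) s`_i * coef a (m - i)) / coef a 0)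
  else [::].

Definition fps_unit : {pred fps R} := fun a => coef a 0 != 0.
Definition fps_inv a : fps R :=
  if fps_unit a then Fps (fun n => (fps_inv_seq a n.+1)`_n) else a.

Lemma size_fps_inv_seq a n : size (fps_inv_seq a n) = n.
Proof. by elim: n => //= n IHn; rewrite size_rcons IHn. Qed.

Lemma nth_fps_inv_seq a n i : (i < n)%N ->
  (fps_inv_seq a n)`_i = (fps_inv_seq a i.+1)`_i.
Proof.
elim: n => // n IHn; rewrite ltnS leq_eqVlt => /predU1P[-> //|lt_in].
by rewrite -IHn //= nth_rcons size_fps_inv_seq lt_in.
Qed.

Lemma coef_fps_inv a n : coef a 0 != 0 ->
  coef (fps_inv a) n =
  ((n == 0)%:R - \sum_(i < n) coef (fps_inv a) i * coef a (n - i)) / coef a 0.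
Proof.
move=> a0; rewrite /fps_inv ifT // [LHS]/=.
rewrite nth_rcons size_fps_inv_seq ltnn eqxx.
congr ((_ - _) / _); apply: eq_bigr => i _.
by rewrite nth_fps_inv_seq.
Qed.

Fact fps_mulV : {in fps_unit, left_inverse 1 fps_inv *%R}.
Proof.
move=> a a0; apply/fpsP => n; rewrite fps_coefM fps_coef1 big_ord_recr /= subnn.
by rewrite [X in _ + X * _]coef_fps_inv // divfK // addrC subrK.
Qed.

Fact fps_unitP a b : b * a = 1 -> fps_unit a.
Proof.
move=> /fpsP /(_ 0%N); rewrite fps_coefM big_ord1 fps_coef1 subnn /= => ba1.
by apply/eqP => a0; move/eqP: ba1; rewrite a0 mulr0 eq_sym oner_eq0.
Qed.

Fact fps_inv_out : {in [predC fps_unit], fps_inv =1 id}.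
Proof. by move=> a /negbTE na; rewrite /fps_inv ifF. Qed.

HB.instance Definition _ :=
  GRing.ComNzRing_hasMulInverse.Build (fps R) fps_mulV fps_unitP fps_inv_out.

Lemma fps_unitE a : (a \is a GRing.unit) = (coef a 0 != 0).
Proof. by []. Qed.

End FpsUnitRing.

Section DegenerateEuler.
Variable R : realType.
Implicit Types (lambda x : R) (n r : nat).

Definition egf (u : nat -> R) : fps R := Fps (fun n => u n / n`!%:R).

Definition dfact lambda x n : R := \prod_(i < n) (x - i%:R * lambda).

(* The binomial expansion of [(1 + lambda t) ^ (x / lambda)]. *)
Definition dexp lambda x : fps R := egf (dfact lambda x).

Definition euler2_gf lambda r x : fps R :=
  (2 / (dexp lambda 1 + dexp lambda (- 1))) ^+ r * dexp lambda x.

Definition euler2 lambda r n x : R := n`!%:R * coef (euler2_gf lambda r x) n.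

Lemma egf_euler2 lambda r x :
  egf (fun n => euler2 lambda r n x) =
  (2 / (dexp lambda 1 + dexp lambda (- 1))) ^+ r * dexp lambda x.
Proof.
apply/fpsP => n; rewrite -/(euler2_gf _ _ _) /= mulrC mulKf //.
by rewrite pnatr_eq0 -lt0n fact_gt0.
Qed.

(* The quotient in [euler2_gf] is therefore a genuine one. *)
Lemma dexp_cosh_unit lambda :
  dexp lambda 1 + dexp lambda (- 1) \is a GRing.unit.
Proof.
rewrite fps_unitE fps_coefD /= /dfact !big_ord0 fact0 divr1.
by rewrite (_ : 1 + 1 = 2%:R) // pnatr_eq0.
Qed.

End DegenerateEuler.

(* Main.v *)
Require Import Defs.
From mathcomp Require Import all_boot all_order all_algebra.
From mathcomp Require Import reals.
From mathcomp Require Import ring.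

(** Since [e_lambda ^ (x + y) = e_lambda ^ x * e_lambda ^ y], multiplying
    [2 = (2 / (e_lambda + e_lambda ^ -1)) * (e_lambda + e_lambda ^ -1)] by the
    generating function of order [r] at [x + 1] gives
    [E^(r+1)(x + 2) + E^(r+1)(x) = 2 E^(r)(x + 1)].  Hence the left-hand side
    at [(r + 1, x)] is twice the left-hand side at [(r, x - 1)]; at [r = 0] it
    is [E^(0)(x + 2) = (x + 2)_(n, lambda)]. *)

Import GRing.Theory Num.Theory.
Local Open Scope ring_scope.

Section DegenerateExponential.
Variables (R : realType) (lambda : R).
Implicit Types (x y : R) (n r : nat).

Lemma dexp0 x : coef (dexp lambda x) 0 = 1.
Proof. by rewrite /= /dfact big_ord0 fact0 divr1. Qed.

(** Coefficient form of [(1 + lambda t) f' = x f] for [f = dexp lambda x]. *)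
Lemma dexpS x n :
  n.+1%:R * coef (dexp lambda x) n.+1 =
  (x - n%:R * lambda) * coef (dexp lambda x) n.
Proof.
have n1 : n.+1%:R != 0 :> R by rewrite pnatr_eq0.
have nf : n`!%:R != 0 :> R by rewrite pnatr_eq0 -lt0n fact_gt0.
rewrite /= /dfact big_ord_recr /= factS natrM.
by field; rewrite nf addrC natr1.
Qed.

(* The coefficients of the product satisfy the recurrence [dexpS] of
   [dexp lambda (x + y)], by the Leibniz rule. *)
Lemma dexpD x y : dexp lambda (x + y) = dexp lambda x * dexp lambda y.
Proof.
apply/fpsP; elim=> [|n IHn].
  by rewrite fps_coefM big_ord1 !dexp0 mulr1.
have n1 : n.+1%:R != 0 :> R by rewrite pnatr_eq0.
apply: (mulfI n1); rewrite dexpS {}IHn !fps_coefM !mulr_sumr.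
set a := coef (dexp lambda x); set b := coef (dexp lambda y).
transitivity (\sum_(i < n.+2) (i%:R * a i) * b (n.+1 - i)%N +
              \sum_(i < n.+2) a i * ((n.+1 - i)%:R * b (n.+1 - i)%N)).
  (* The first sum vanishes at [i = 0], the second at [i = n.+1]; shifting the first aligns them. *)
  rewrite [X in _ = X + _]big_ord_recl [X in _ = _ + X]big_ord_recr /= subnn !mul0r.
  rewrite mulr0 add0r addr0 -big_split; apply: eq_bigr => i _ /=.
  have le_in : (i <= n)%N by rewrite -ltnS.
  rewrite /bump add1n subSS (subSn le_in) !dexpS -/a -/b natrB //.
  by ring.
rewrite -big_split; apply: eq_bigr => i _ /=.
by rewrite natrB ?leq_ord //; ring.
Qed.

Lemma euler2_order0 n x : euler2 lambda 0 n x = dfact lambda x n.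
Proof.
rewrite /euler2 /euler2_gf expr0 mul1r /= mulrC divfK //.
by rewrite pnatr_eq0 -lt0n fact_gt0.
Qed.

Lemma euler2_orderS r n x :
  euler2 lambda r.+1 n (x + 2) + euler2 lambda r.+1 n x =
  2 * euler2 lambda r n (x + 1).
Proof.
rewrite /euler2 -mulrDr -fps_coefD mulrCA; congr (_ * _).
suff -> : euler2_gf lambda r.+1 (x + 2) + euler2_gf lambda r.+1 x =
          2 * euler2_gf lambda r (x + 1).
  by rewrite !mulr_natl !mulr2n fps_coefD.
rewrite /euler2_gf; set G := 2 / _.
have GE : G * (dexp lambda 1 + dexp lambda (- 1)) = 2.
  by rewrite /G divrK // dexp_cosh_unit.
(* Centring both arguments at [x + 1] lets [e_lambda + e_lambda ^ -1] factor out. *)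
have -> : x + 2 = x + 1 + 1 by rewrite -addrA.
have -> : dexp lambda x = dexp lambda (x + 1 - 1) by rewrite addrK.
rewrite 2!(dexpD (x + 1)) -GE exprS.
by ring.
Qed.

End DegenerateExponential.

Theorem theorem5 (R : realType) (lambda : R) (hlambda : lambda != 0)
    (n r : nat) (hr : (0 < r)%N) (x : R) :
  euler2 lambda r n (x + 2)
    + \sum_(l < r) 2 ^+ l * euler2 lambda (r - l)%N n (x - l%:R)
  = 2 ^+ r * dfact lambda (x - r%:R + 2) n.
Proof.
clear hlambda hr; elim: r x => [|r IHr] x.
  by rewrite big_ord0 addr0 expr0 mul1r subr0 euler2_order0.
(* The term [l = 0] pairs with the one at [x + 2]; the others form twice the sum for [r] at
   [x - 1]. *)
rewrite big_ord_recl expr0 mul1r subn0 subr0 addrA euler2_orderS.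
have -> : x - r.+1%:R + 2 = x - 1 - r%:R + 2 by rewrite -natr1; ring.
rewrite exprS -mulrA -IHr mulrDr mulr_sumr; congr (2 * euler2 _ _ _ _ + _).
  by ring.
apply: eq_bigr => i _; rewrite /= /bump add1n subSS exprS -mulrA.
by congr (_ * (_ * euler2 _ _ _ _)); rewrite -natr1; ring.
Qed.
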